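(* Let $N\ge 2$ and let $D=(D_{ij})_{1\le i,j\le N}$ be a real symmetric $N\times N$ matrix with $D_{ii}=0$ for all $i$ (the distance matrix of a symmetric $N$-city traveling salesman problem). For a permutation $\sigma\in S_N$ put $L_\sigma(D)=\sum_{i=1}^N D_{\sigma(i),\sigma(i+1)}$ with $\sigma(N+1):=\sigma(1)$, and let $L_{min}(D)=\min_{\sigma\in S_N}L_\sigma(D)$. Let $\mathbf 1=(1,\dots,1)^T\in\mathbb R^N$, $J=\mathbf 1\mathbf 1^T$, $P_{\mathbf 1^\perp}=I-\frac1N J$, and let $\mu_1\ge\mu_2\ge\dots\ge\mu_{N-1}$ be the eigenvalues (with multiplicity) of the restriction of $-P_{\mathbf 1^\perp}DP_{\mathbf 1^\perp}$ to the subspace $\mathbf 1^\perp$ (equivalently, the eigenvalues of $-P_{\mathbf 1^\perp}DP_{\mathbf 1^\perp}$ with the trivial eigenvalue $0$ belonging to the eigenvector $\mathbf 1$ removed). Let $c_1\le c_2\le\dots\le c_{N-1}$ be the numbers $1-\cos(2\pi k/N)$, $k=1,\dots,N-1$, listed with multiplicity in increasing order, and define $\varphi(D)=\sum_{k=1}^{N-1}c_k\mu_k$. Then $$L_{min}(D)\ge\varphi(D).$$ Explicitly, $\varphi(D)=\sum_{k=1}^{(N-1)/2}\bigl(1-\cos\frac{2\pi k}{N}\bigr)(\mu_{2k-1}+\mu_{2k})$ if $N$ is odd, and $\varphi(D)=\sum_{k=1}^{N/2-1}\bigl(1-\cos\frac{2\pi k}{N}\bigr)(\mu_{2k-1}+\mu_{2k})+2\mu_{N-1}$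 if $N$ is even.
   Context: $L_{min}(D)$ is the length of the shortest roundtrip (Hamiltonian cycle) in the complete graph on $N$ cities with edge lengths $D_{ij}$, i.e. the optimal value of the traveling salesman problem. $S_N$ denotes the set of permutations of $\{1,\dots,N\}$. *)

(* Defs.v *)
From mathcomp Require Import all_boot all_order all_algebra all_fingroup.
From mathcomp Require Import reals trigo.
From mathcomp Require Import polyrcf.

Set Implicit Arguments.
Unset Strict Implicit.
Unset Printing Implicit Defensive.

Import Order.TTheory GRing.Theory Num.Theory.
Local Open Scope ring_scope.

(* Cities are 'I_N; ordS is the cyclic successor, so the last city of the
   tour is followed by the first one. *)
Definition tour_length (R : realType) (N : nat) (D : 'M[R]_N) (s : 'S_N) : R :=
  \sum_(i < N) D (s i) (s (ordS i)).

(* The default value of the minimum is the length of the identity tour, one of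
   the competitors, so this is the minimum over 'S_N. *)
Definition Lmin (R : realType) (N : nat) (D : 'M[R]_N) : R :=
  \big[Num.min/tour_length D 1%g]_(s : 'S_N) tour_length D s.

Definition ones (R : realType) (N : nat) : 'cV[R]_N := const_mx 1.

(* The row space of this matrix is the hyperplane { v | v *m ones = 0 }. *)
Definition ones_orth (R : realType) (N : nat) : 'M[R]_N := kermx (ones R N).

Definition proj_ones_orth (R : realType) (N : nat) : 'M[R]_N :=
  1%:M - N%:R^-1 *: (ones R N *m (ones R N)^T).

(* The real roots of the characteristic polynomial, each repeated according to
   its multiplicity, in decreasing order. *)
Definition spectrum (R : realType) (n : nat) (A : 'M[R]_n) : seq R :=
  sort (fun x y : R => y <= x)
    (flatten [seq nseq (mup x (char_poly A)) x | x <- rootsR (char_poly A)]).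

(* restrictmx V A is the matrix, in a basis of the row space of V, of the map
   v |-> v *m A restricted to that space; here V is stable under A.  For
   symmetric D the matrix A is symmetric, so acting on row vectors or on column
   vectors gives the same operator. *)
Definition projected_restriction (R : realType) (N : nat) (D : 'M[R]_N) :
    'M[R]_(\rank (ones_orth R N)) :=
  restrictmx (ones_orth R N)
    (- (proj_ones_orth R N *m D *m proj_ones_orth R N)).

(* Indices k run from 1 to N - 1. *)
Definition mu (R : realType) (N : nat) (D : 'M[R]_N) (k : nat) : R :=
  (spectrum (projected_restriction D))`_k.-1.

Definition cosgap (R : realType) (N k : nat) : R :=
  1 - cos (2 * pi * k%:R / N%:R).

Definition cseq (R : realType) (N k : nat) : R :=
  (sort <=%R [seq cosgap R N j | j <- iota 1 N.-1])`_k.-1.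

Definition phi (R : realType) (N : nat) (D : 'M[R]_N) : R :=
  \sum_(1 <= k < N) cseq R N k * mu D k.

(* Main.v *)
Require Import Defs.
From mathcomp Require Import all_boot all_order all_algebra all_fingroup.
From mathcomp Require Import reals trigo.
From mathcomp Require Import polyrcf complex.
From mathcomp Require Import zify ring lra.

(** With [nu] the cyclic successor along the tour [s], [L_s = - tr (D L)] where
    [L = 1 - (P_nu + P_nu^T) / 2].  The Fourier matrix diagonalises [L] with
    eigenvalues [1 - cos (2 pi k / N)], and [L] kills [ones], so [D] may be
    replaced by [P D P] and then shifted by any multiple of [J].  The bound is
    the trace inequality
    [tr (A B) >= sum of the eigenvalues of A (decreasing) times those of B
    (increasing)] for symmetric [A] and [B]: the squared moduli of the entries
    of the change of eigenbasis form a doubly stochastic matrix. *)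

Set Implicit Arguments.
Unset Strict Implicit.
Unset Printing Implicit Defensive.

Import Order.TTheory GRing.Theory Num.Theory.
Local Open Scope ring_scope.

(** * Characteristic polynomials and sorted spectra *)

(** [P (X - A) = (X - B) P], and the nonzero [\det P] cancels. The sizes are only propositionally
    equal, so that [P] may be a stacked basis with [1 + \rank _] rows. *)
Lemma char_poly_intertwined (F : fieldType) m n (P : 'M[F]_(m, n)) A B :
  m = n -> row_free P -> P *m A = B *m P -> char_poly B = char_poly A.
Proof.
move=> e; case: n / e in P A *; rewrite row_free_unit => Pu PA.
have detP0 : \det (map_mx polyC P) != 0.
  by rewrite det_map_mx polyC_eq0 -unitfE -unitmxE.
apply: (mulIf detP0); rewrite /char_poly -det_mulmx mulrC -det_mulmx.
congr (\det _); rewrite /char_poly_mx mulmxBl mulmxBr -!map_mxM PA.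
by rewrite scalar_mxC.
Qed.

Lemma char_poly_diag (F : comNzRingType) n (d : 'rV[F]_n) :
  char_poly (diag_mx d) = \prod_(i < n) ('X - (d 0 i)%:P).
Proof.
rewrite char_poly_trig ?diag_mx_is_trig//.
by apply: eq_bigr => i _; rewrite mxE eqxx mulr1n.
Qed.

Lemma spectrum_prod_XsubC (R : realType) n (A : 'M[R]_n) (s : seq R) :
  char_poly A = \prod_(x <- s) ('X - x%:P) ->
  spectrum A = sort (fun x y : R => y <= x) s.
Proof.
move=> As; have A0 : char_poly A != 0 by rewrite monic_neq0 ?char_poly_monic.
apply/perm_sortP; first by move=> x y; exact: le_total.
- by move=> y x z yx zy; exact: le_trans zy yx.
- by move=> x y xy; apply/le_anti; rewrite andbC.
apply/allP => x _ /=; apply/eqP; rewrite -(mu_prod_XsubC x s) -As.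
rewrite count_flatten -map_comp sumnE big_map.
(* Only the block of copies of [x] itself contributes to the count of [x]. *)
rewrite (eq_bigr (fun y => if y == x then mup x (char_poly A) else 0)%N); last first.
  by move=> y _ /=; rewrite count_nseq /=; case: eqP => [->|_]; rewrite ?mul1n ?mul0n.
have [xr|xNr] := boolP (x \in rootsR (char_poly A)).
  rewrite (bigD1_seq x) ?uniq_roots//= eqxx big1 ?addn0// => y /negPf.
  by rewrite eq_sym => ->.
rewrite big_seq big1 => [|y yr].
  apply/esym/mupNroot; apply: contraNN xNr => rx.
  by rewrite -roots_on_rootsR// in_itv.
by case: eqP xNr => // <-; rewrite yr.
Qed.

(** * Rearrangement for doubly stochastic weights *)

(** Take for [u] the discrete integral of [b] against the increments of [a]. Between [j] and [i],
    freezing [b] at its value in [j] can only increase the integral, by the opposite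
    monotonicities. *)
Lemma rearrangement_potential (R : realDomainType) n (a b : nat -> R) :
  (forall i, (i.+1 < n)%N -> a i.+1 <= a i) ->
  (forall i, (i.+1 < n)%N -> b i <= b i.+1) ->
  exists u : nat -> R, forall i j, (i < n)%N -> (j < n)%N ->
    u i - u j <= (a i - a j) * b j.
Proof.
move=> adec binc.
have bmono i j : (i <= j)%N -> (j < n)%N -> b i <= b j.
  elim: j => [|j IH]; first by rewrite leqn0 => /eqP->.
  rewrite leq_eqVlt => /orP[/eqP->//|]; rewrite ltnS => ij jn.
  exact: le_trans (IH ij (ltnW jn)) (binc j jn).
pose u i := \sum_(k < i) (a k.+1 - a k) * b k.
have uS i : u i.+1 = u i + (a i.+1 - a i) * b i by rewrite /u big_ord_recr.
exists u => i j lin ljn; case: (leqP j i) => [|/ltnW].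
  elim: i lin => [|i IH] lin; first by rewrite leqn0 => /eqP->; rewrite !subrr mul0r.
  rewrite leq_eqVlt => /orP[/eqP->|]; first by rewrite !subrr mul0r.
  rewrite ltnS => ji; have := IH (ltnW lin) ji.
  have := adec i lin; have := bmono j i ji (ltnW lin); rewrite uS.
  nra.
elim: j ljn => [|j IH] ljn; first by rewrite leqn0 => /eqP->; rewrite !subrr mul0r.
rewrite leq_eqVlt => /orP[/eqP->|]; first by rewrite !subrr mul0r.
rewrite ltnS => ij; have := IH (ltnW ljn) ij.
(* This amounts to [(a i - a j.+1) * (b j.+1 - b j) >= 0]. *)
suff : (a i - a j) * b j <= (a i - a j.+1) * b j.+1 - (a j - a j.+1) * b j.
  rewrite uS; nra.
have aij : a j <= a i.
  elim: {IH} j ljn ij => [|j IH] ljn; first by rewrite leqn0 => /eqP->.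
  rewrite leq_eqVlt => /orP[/eqP->//|]; rewrite ltnS => ij.
  exact: le_trans (adec j (ltnW ljn)) (IH (ltnW ljn) ij).
have := adec j ljn; have := binc j ljn; nra.
Qed.

(* [u i + v j <= a i * b j], with equality for [i = j], is a feasible solution
   of the transportation dual; it certifies that the identity is optimal. *)
Lemma doubly_stochastic_rearrangement (R : realDomainType) n (a b : nat -> R)
    (S : 'I_n -> 'I_n -> R) :
  (forall i, (i.+1 < n)%N -> a i.+1 <= a i) ->
  (forall i, (i.+1 < n)%N -> b i <= b i.+1) ->
  (forall i j, 0 <= S i j) ->
  (forall i, \sum_j S i j = 1) ->
  (forall j, \sum_i S i j = 1) ->
  \sum_(i < n) a i * b i <= \sum_(i < n) \sum_(j < n) a i * b j * S i j.
Proof.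
move=> adec binc S0 Sr Sc.
have [u uP] := @rearrangement_potential _ _ _ _ adec binc.
pose v j := a j * b j - u j.
have -> : \sum_(i < n) a i * b i = \sum_(i < n) \sum_(j < n) (u i + v j) * S i j.
  transitivity (\sum_(i < n) u i + \sum_(i < n) v i).
    by rewrite -big_split; apply: eq_bigr => i _; rewrite /= addrC subrK.
  under [RHS]eq_bigr do under eq_bigr do rewrite mulrDl.
  under [RHS]eq_bigr do rewrite big_split /= -mulr_sumr Sr mulr1.
  rewrite [RHS]big_split /=; congr (_ + _); rewrite exchange_big /=.
  by apply: eq_bigr => j _; rewrite -mulr_sumr Sc mulr1.
apply: ler_sum => i _; apply: ler_sum => j _; apply: ler_wpM2r => //.
by have := uP i j (ltn_ord i) (ltn_ord j); rewrite /v; lra.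
Qed.

(** * Spectral theorem and trace inequality *)

Section Spectral.
Local Notation RtoC := (real_complex _).
Local Open Scope complex_scope.
Local Open Scope sesquilinear_scope.

(** Over [R[i]] the matrix is Hermitian, hence unitarily diagonalisable with real eigenvalues; the
    factorisation descends to [R] because the embedding of polynomials is injective. *)
Lemma symmetric_spectral (R : rcfType) n (A : 'M[R]_n) : A^T = A ->
  exists (d : 'rV[R]_n) (U : 'M[R[i]]_n),
    [/\ U \is unitarymx,
        map_mx RtoC A = U ^t* *m diag_mx (map_mx RtoC d) *m U
      & char_poly A = \prod_(i < n) ('X - (d 0 i)%:P)].
Proof.
move=> Asym; set A' := map_mx RtoC A.
have A'h : A' \is hermsymmx.
  apply: realsym_hermsym.
    by apply/is_hermitianmxP; rewrite expr0 scale1r map_mx_id// /A' map_trmx Asym.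
  by apply/mxOverP => i j; rewrite mxE complex_real.
set U := spectralmx A'; set d' := spectral_diag A'.
have Uu : U \is unitarymx := spectral_unitarymx _.
have d'r : d' \is a mxOver Num.real := hermitian_spectral_diag_real A'h.
have E : A' = invmx U *m diag_mx d' *m U.
  exact/orthomx_spectralP/hermitian_normalmx.
pose d : 'rV[R]_n := map_mx (@complex.Re R) d'.
have d'E : d' = map_mx RtoC d.
  by apply/rowP => j; rewrite !mxE RRe_real//; apply/mxOverP.
exists d, U; split; first exact: Uu.
  by rewrite -/A' E (invmx_unitary Uu) d'E.
apply: (map_poly_inj RtoC); rewrite map_char_poly rmorph_prod -/A'.
rewrite -(@char_poly_intertwined _ _ _ U A' (diag_mx d'))//.
- rewrite char_poly_diag; apply: eq_bigr => i _.
  by rewrite rmorphB /= map_polyX map_polyC/= d'E mxE.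
- by rewrite row_free_unit unitarymx_unit.
- by rewrite E !mulmxA mulmxV ?mul1mx// unitarymx_unit.
Qed.


Lemma trace_symmetric_mul (R : rcfType) n (A B : 'M[R]_n) :
  A^T = A -> B^T = B ->
  exists (a b : 'rV[R]_n) (S : 'I_n -> 'I_n -> R),
    [/\ char_poly A = \prod_(i < n) ('X - (a 0 i)%:P),
        char_poly B = \prod_(i < n) ('X - (b 0 i)%:P),
        (forall i j, 0 <= S i j),
        (forall i, \sum_j S i j = 1) /\ (forall j, \sum_i S i j = 1)
      & \tr (A *m B) = \sum_i \sum_j a 0 i * b 0 j * S i j].
Proof.
move=> /symmetric_spectral[a [U [Uu AE Ap]]] /symmetric_spectral[b [V [Vu BE Bp]]].
(* The change of eigenbasis. It is kept behind an equation so that [mxE] does not unfold its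
   entries. Its squared moduli form [S]; the unit norms of its rows and columns give the sums 1. *)
have [W WE] : {W | W = U *m V^t*} by exists (U *m V^t*).
have Wu : W \is unitarymx.
  by rewrite WE; apply: mul_unitarymx Uu _; rewrite trmxC_unitary.
have W'u : W^t* \is unitarymx by rewrite trmxC_unitary.
pose S i j := complex.Re (W i j * (W i j)^*).
have SE i j : (S i j)%:C = W i j * (W i j)^*.
  by rewrite /S RRe_real// ger0_real// mul_conjC_ge0.
exists a, b, S; split=> //.
- by move=> i j; rewrite -(@lecR R) SE mul_conjC_ge0.
- split=> i; apply: (@complexI R); rewrite rmorph_sum rmorph1.
    have /unitarymxP/matrixP/(_ i i) := Wu; rewrite !mxE eqxx mulr1n => <-.
    by apply: eq_bigr => j _; rewrite /= SE !mxE.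
  have /unitarymxP/matrixP/(_ i i) := W'u; rewrite !mxE eqxx mulr1n => <-.
  by apply: eq_bigr => j _; rewrite /= SE !mxE conjCK mulrC.
apply: (@complexI R); rewrite -trace_map_mx map_mxM AE BE.
(* Cycling [U ^t*] to the end lets [U] and [V] combine into [W] and its adjoint. *)
rewrite -!mulmxA mxtrace_mulC !mulmxA.
have -> : diag_mx (map_mx RtoC a) *m U *m V ^t* *m diag_mx (map_mx RtoC b) *m V *m U ^t* =
  diag_mx (map_mx RtoC a) *m (W *m (diag_mx (map_mx RtoC b) *m W ^t*)).
  by rewrite WE trmx_mul map_mxM trmxCK !mulmxA.
rewrite /mxtrace rmorph_sum; apply: eq_bigr => i _.
rewrite mul_diag_mx !mxE rmorph_sum mulr_sumr; apply: eq_bigr => j _.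
by rewrite mul_diag_mx !mxE !rmorphM /= SE; ring.
Qed.

Lemma perm_eq_nth_ord (T : eqType) n (x0 : T) (a : 'I_n -> T) (s : seq T) :
  perm_eq s [seq a i | i <- index_enum 'I_n] ->
  exists p : 'S_n, forall i : 'I_n, nth x0 s i = a (p i).
Proof.
move=> sa; have ss : size s == n.
  by rewrite (perm_size sa) size_map /index_enum -enumT size_enum_ord.
have /tuple_permP[p ps] : perm_eq (Tuple ss) (mktuple a).
  by rewrite /= enumT.
exists p => i; have -> : nth x0 s i = tnth (Tuple ss) i by rewrite (tnth_nth x0).
by rewrite (val_inj ps) !tnth_mktuple.
Qed.

(** The diagonalisations list eigenvalues in no particular order. Permutations [p] and [q] match
    them with the sorted lists, and permuting the rows and columns of [S] keeps it doubly
    stochastic. *)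
Lemma trace_mul_ge (R : rcfType) n (A B : 'M[R]_n) (s t : seq R) :
  A^T = A -> B^T = B ->
  char_poly A = \prod_(x <- s) ('X - x%:P) ->
  char_poly B = \prod_(x <- t) ('X - x%:P) ->
  sorted (fun x y : R => y <= x) s -> sorted <=%R t ->
  \sum_(i < n) s`_i * t`_i <= \tr (A *m B).
Proof.
move=> Asym Bsym As Bt ss st.
have [a [b [S [Aa Bb S0 [Sr Sc] ->]]]] := trace_symmetric_mul Asym Bsym.
have sP : perm_eq s [seq a 0 i | i <- index_enum 'I_n].
  by apply: prod_XsubC_eq; rewrite -As Aa big_map.
have tP : perm_eq t [seq b 0 i | i <- index_enum 'I_n].
  by apply: prod_XsubC_eq; rewrite -Bt Bb big_map.
have szs : size s = n by rewrite (perm_size sP) size_map /index_enum -enumT size_enum_ord.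
have szt : size t = n by rewrite (perm_size tP) size_map /index_enum -enumT size_enum_ord.
have [p pP] := perm_eq_nth_ord 0 sP; have [q qP] := perm_eq_nth_ord 0 tP.
have -> : \sum_i \sum_j a 0 i * b 0 j * S i j =
          \sum_(i < n) \sum_(j < n) s`_i * t`_j * S (p i) (q j).
  rewrite (reindex_inj (@perm_inj _ p)); apply: eq_bigr => i _.
  by rewrite (reindex_inj (@perm_inj _ q)); apply: eq_bigr => j _; rewrite pP qP.
apply: (@doubly_stochastic_rearrangement _ _ _ _ (fun i j => S (p i) (q j))) => //.
- by move=> i; rewrite -szs => /(sortedP 0 ss).
- by move=> i; rewrite -szt => /(sortedP 0 st).
- by move=> i; rewrite -[RHS](Sr (p i)) [RHS](reindex_inj (@perm_inj _ q)).
- by move=> j; rewrite -[RHS](Sc (q j)) [RHS](reindex_inj (@perm_inj _ p)).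
Qed.

End Spectral.


(** * Fourier diagonalisation of the tour Laplacian *)

Section CyclicLaplacian.
Local Notation RtoC := (real_complex _).
Local Open Scope complex_scope.
Variable R : realType.

Definition cis (x : R) : R[i] := cos x +i* sin x.

Lemma cis_expn x k : cis x ^+ k = cis (x *+ k).
Proof.
elim: k => [|k IH]; first by rewrite expr0 mulr0n /cis cos0 sin0.
rewrite exprSr IH mulrSr /cis cosD sinD; simpc.
by congr (_ +i* _); ring.
Qed.

Lemma cis_neq0 x : cis x != 0.
Proof.
apply/eqP => -[c0 s0]; have := cos2Dsin2 x; rewrite c0 s0 expr0n addr0.
by move/esym/eqP; rewrite oner_eq0.
Qed.

Lemma cisDV x : cis x + (cis x)^-1 = (2 * cos x)%:C.
Proof.
have -> : (cis x)^-1 = cos x -i* sin x.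
  apply: (mulfI (cis_neq0 x)); rewrite mulfV ?cis_neq0// /cis; simpc.
  by rewrite -!expr2 cos2Dsin2 mulrC addNr.
by rewrite /cis; simpc; rewrite mulr_natl mulr2n.
Qed.

Variable N : nat.
Hypothesis N_gt0 : (0 < N)%N.

Definition root_of_unity := cis (2 * pi / N%:R).
Local Notation z := root_of_unity.

Lemma root_of_unityX k : z ^+ k = cis (2 * pi * k%:R / N%:R).
Proof. by rewrite cis_expn -[_ *+ k]mulr_natr mulrAC. Qed.

Lemma root_of_unity_expN : z ^+ N = 1.
Proof.
rewrite root_of_unityX mulfK ?pnatr_eq0 -?lt0n// /cis mulr_natl cos2pi sin2pi.
by [].
Qed.

(** The real part is [1 - 2 sin^2(pi k / N)], and the sine is positive since its angle lies strictly
    between 0 and [pi]. *)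
Lemma root_of_unity_neq1 k : (0 < k < N)%N -> z ^+ k != 1.
Proof.
move=> /andP[k0 kN]; rewrite root_of_unityX; apply/eqP => -[+ _].
have -> : 2 * pi * k%:R / N%:R = (pi * (k%:R / N%:R)) *+ 2 :> R.
  by rewrite -[RHS]mulr_natl !mulrA.
rewrite cos_mulr2n cos2sin2.
have : 0 < sin (pi * (k%:R / N%:R) : R).
  apply: sin_gt0_pi; rewrite mulr_gt0 ?pi_gt0 ?divr_gt0 ?ltr0n//=.
  by rewrite gtr_pMr ?pi_gt0// ltr_pdivrMr ?ltr0n// mul1r ltr_nat.
by move=> s0 e; have := exprn_gt0 2 s0; lra.
Qed.

Definition fourier_mx := Vandermonde N (\row_(j < N) z ^+ j).

Lemma fourier_mxE i j : fourier_mx i j = (z ^+ i) ^+ j.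
Proof. by rewrite !mxE exprAC. Qed.

(** The Vandermonde nodes are distinct: factoring [z ^+ i] out of a difference leaves
    [z ^+ (j - i) - 1]. *)
Lemma fourier_mx_unit : fourier_mx \in unitmx.
Proof.
rewrite unitmxE unitfE det_Vandermonde; apply/prodf_neq0 => i _.
apply/prodf_neq0 => j ij; rewrite !mxE subr_eq0.
rewrite -(subnKC (ltnW ij)) exprD -subr_eq0 -[X in _ - X]mulr1 -mulrBr.
rewrite mulf_neq0 ?expf_neq0 ?cis_neq0// subr_eq0 root_of_unity_neq1//.
by rewrite subn_gt0 ij (leq_ltn_trans (leq_subr _ _)).
Qed.

Definition cyclic_perm : 'S_N := perm (@ordS_inj N).

(** Shifting the column index multiplies row [i] by [z ^+ i]; the wrap-around at the last column is
    harmless because [z ^+ N = 1]. *)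
Lemma fourier_mx_cyclicV :
  fourier_mx *m perm_mx cyclic_perm^-1 = diag_mx (\row_i z ^+ i) *m fourier_mx.
Proof.
apply/matrixP => i j; rewrite -col_permE mul_diag_mx [LHS]mxE [RHS]mxE.
rewrite !fourier_mxE permE mxE /= -exprS expr_mod//.
by rewrite exprAC root_of_unity_expN expr1n.
Qed.

Lemma fourier_mx_cyclic :
  fourier_mx *m perm_mx cyclic_perm = diag_mx (\row_i (z ^+ i)^-1) *m fourier_mx.
Proof.
have zz : diag_mx (\row_(i < N) (z ^+ i)^-1) *m diag_mx (\row_i z ^+ i) = 1%:M.
  rewrite mulmx_diag -diag_const_mx; congr diag_mx; apply/rowP => i.
  by rewrite !mxE mulVf// expf_neq0// cis_neq0.
rewrite -[fourier_mx in LHS]mul1mx -zz -[_ *m fourier_mx]mulmxA -fourier_mx_cyclicV.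
by rewrite -!mulmxA -perm_mxM mulVg perm_mx1 mulmx1.
Qed.

(** Half the Laplacian of the multigraph with one edge from each [i] to [s i]. *)
Definition half_laplacian (s : 'S_N) : 'M[R]_N :=
  1%:M - 2^-1 *: (perm_mx s + perm_mx s^-1).

Lemma char_poly_cyclic_laplacian :
  char_poly (half_laplacian cyclic_perm) =
    \prod_(i < N) ('X - (cosgap R N i)%:P).
Proof.
apply: (map_poly_inj RtoC); rewrite map_char_poly rmorph_prod /=.
rewrite -(@char_poly_intertwined _ _ _ fourier_mx _
  (diag_mx (\row_i (cosgap R N i)%:C)))//.
- rewrite char_poly_diag; apply: eq_bigr => i _.
  by rewrite rmorphB /= map_polyX map_polyC/= mxE.
- by rewrite row_free_unit fourier_mx_unit.
rewrite map_mxB map_mx1 map_mxZ map_mxD !map_perm_mx.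
rewrite mulmxBr mulmx1 -scalemxAr mulmxDr fourier_mx_cyclicV fourier_mx_cyclic.
move: fourier_mx => F; apply/matrixP => i j; rewrite !mul_diag_mx !mxE.
rewrite -mulrDl root_of_unityX [_^-1 + _]addrC cisDV mulrA -rmorphM mulKf ?pnatr_eq0//.
by rewrite /cosgap rmorphB mulrBl mul1r.
Qed.

Lemma half_laplacian_conj (s t : 'S_N) :
  perm_mx t *m half_laplacian (t^-1 * s * t)%g = half_laplacian s *m perm_mx t.
Proof.
have conj u : (t * (t^-1 * u * t) = u * t)%g by rewrite !mulgA mulgV mul1g.
have conjV : ((t^-1 * s * t)^-1 = t^-1 * s^-1 * t)%g.
  by rewrite !invMg invgK mulgA.
rewrite /half_laplacian conjV mulmxBr mulmxBl mulmx1 mul1mx -scalemxAr -scalemxAl.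
by rewrite mulmxDr mulmxDl -!perm_mxM !conj.
Qed.

(** Permutations compose from left to right, so [s^-1 * cyclic_perm * s] sends [s i] to
    [s (ordS i)]: it is the successor along the tour, and a conjugate of [cyclic_perm]. *)
Lemma char_poly_tour_laplacian (s : 'S_N) :
  char_poly (half_laplacian (s^-1 * cyclic_perm * s)%g) =
    \prod_(i < N) ('X - (cosgap R N i)%:P).
Proof.
rewrite -char_poly_cyclic_laplacian; apply/esym.
apply: (@char_poly_intertwined _ _ _ (perm_mx s)) => //.
  by rewrite row_free_unit unitmx_perm.
exact: half_laplacian_conj.
Qed.

Lemma half_laplacian_sym (s : 'S_N) : (half_laplacian s)^T = half_laplacian s.
Proof.
rewrite /half_laplacian linearB linearZ linearD /= trmx1 !tr_perm_mx invgK.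
by rewrite [perm_mx _ + _]addrC.
Qed.

Lemma half_laplacian_ones (s : 'S_N) : half_laplacian s *m ones R N = 0.
Proof.
have P (t : 'S_N) : perm_mx t *m ones R N = ones R N.
  by rewrite -row_permE; apply/matrixP => i j; rewrite !mxE.
rewrite mulmxBl mul1mx -scalemxAl mulmxDl !P -mulr2n -scaler_nat scalerA.
by rewrite mulVf ?pnatr_eq0// scale1r subrr.
Qed.

(** The zero diagonal removes the identity term, and symmetry gives both permutation matrices the
    same trace, which cancels the factor one half. *)
Lemma tour_length_trace (D : 'M[R]_N) (s : 'S_N) :
  D^T = D -> (forall i, D i i = 0) ->
  \tr (D *m half_laplacian (s^-1 * cyclic_perm * s)%g) = - tour_length D s.
Proof.
move=> Dsym D0; set c := (s^-1 * _ * s)%g.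
have trP t : \tr (D *m perm_mx t^-1) = \sum_i D i (t i).
  by rewrite -col_permE; apply: eq_bigr => i _; rewrite mxE.
have trPV t : \tr (D *m perm_mx t) = \tr (D *m perm_mx t^-1).
  by rewrite -mxtrace_tr trmx_mul Dsym tr_perm_mx mxtrace_mulC.
rewrite mulmxBr mulmx1 -scalemxAr mulmxDr linearB linearZ linearD /=.
rewrite trPV -mulr2n -[\tr _ *+ 2]mulr_natl mulKf ?pnatr_eq0// trP.
rewrite {1}/mxtrace big1 ?sub0r => [|i _]; last exact: D0.
congr (- _); rewrite /tour_length (reindex_inj (@perm_inj _ s)).
by apply: eq_bigr => i _; rewrite !permM permK permE.
Qed.

End CyclicLaplacian.

(** * Projection onto the hyperplane orthogonal to [ones] *)

Section Projection.
Variables (R : realType) (N : nat).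
Hypothesis N_gt0 : (0 < N)%N.
Local Notation one := (ones R N).
Local Notation P := (proj_ones_orth R N).

Lemma trmx_ones_ones : one^T *m one = N%:R%:M.
Proof.
apply/matrixP => i j; rewrite !mxE !ord1 eqxx mulr1n.
under eq_bigr do rewrite !mxE mulr1.
by rewrite sumr_const card_ord.
Qed.

Let N_neq0 : N%:R != 0 :> R.
Proof. by rewrite pnatr_eq0 -lt0n. Qed.

Lemma proj_ones_orth_ones : P *m one = 0.
Proof.
rewrite mulmxBl mul1mx -scalemxAl -mulmxA trmx_ones_ones mul_mx_scalar.
by rewrite scalerA mulVf// scale1r subrr.
Qed.

Lemma proj_ones_orth_sym : P^T = P.
Proof. by rewrite /proj_ones_orth linearB linearZ /= trmx1 trmx_mul trmxK. Qed.

Lemma rank_ones_orth : (\rank (ones_orth R N)).+1 = N.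
Proof.
rewrite mxrank_ker -subSn ?rank_leq_row//.
have -> : \rank one = 1%N; last by rewrite subn1.
apply/eqP; rewrite eqn_leq rank_leq_col lt0n mxrank_eq0.
apply/eqP => /matrixP/(_ (Ordinal N_gt0) 0); rewrite !mxE => /eqP.
by rewrite oner_eq0.
Qed.

(** In a basis made of [ones] and a basis of the hyperplane the matrix is block diagonal: the added
    term acts as [t] on [ones] and as 0 on the hyperplane, while the projected part kills [ones]. *)
Lemma char_poly_projected (D : 'M[R]_N) (t : R) :
  char_poly (- (P *m D *m P) + (t / N%:R) *: (one *m one^T)) =
    ('X - t%:P) * char_poly (projected_restriction D).
Proof.
set A := - (P *m D *m P); set M := projected_restriction D.
pose V := row_base (ones_orth R N).
have V1 : V *m one = 0.
  by apply/sub_kermxP; rewrite eq_row_base.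
have A1 : A *m one = 0.
  by rewrite mulNmx -[_ *m one]mulmxA proj_ones_orth_ones mulmx0 oppr0.
have oneA : one^T *m A = 0.
  rewrite mulmxN !mulmxA -[X in _ *m X *m D]proj_ones_orth_sym -trmx_mul.
  by rewrite proj_ones_orth_ones trmx0 !mul0mx oppr0.
(* The restricted matrix intertwines because the hyperplane is stable: [A] kills [ones], so the rows
   of [V *m A] stay orthogonal to it. *)
have VA : V *m A = M *m V.
  rewrite /M /projected_restriction /conjmx mulmxKpV// -/A.
  rewrite eq_row_base; apply/sub_kermxP.
  by rewrite -mulmxA A1 mulmx0.
have Vfree : row_free V by exact: row_base_free.
clearbody V.
(* Multiplying a vanishing combination by [ones] isolates [N] times the coefficient of [ones];
   freeness of [V] handles the rest. *)
have VQ : row_free (col_mx one^T V).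
  apply: inj_row_free => v; rewrite -[v]hsubmxK mul_row_col => v0.
  have l0 : lsubmx v = 0.
    have /(congr1 (mulmx^~ one)) := v0.
    rewrite /= mulmxDl -!mulmxA V1 mulmx0 addr0 mul0mx trmx_ones_ones mul_mx_scalar.
    by move/eqP; rewrite scaler_eq0 (negPf N_neq0) => /eqP.
  move/eqP: v0; rewrite l0 mul0mx add0r mulmx_free_eq0//.
  by move=> /eqP->; rewrite row_mx0.
rewrite -(@char_poly_intertwined _ _ _ (col_mx one^T V) _ (block_mx t%:M 0 0 M))//.
- rewrite /char_poly char_block_diag_mx det_ublock; congr (_ * _).
  by rewrite det_mx11 !mxE.
- exact: rank_ones_orth.
rewrite mul_col_mx mul_block_col !mul0mx addr0 add0r !mulmxDr oneA add0r VA.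
rewrite -!scalemxAr [V *m (_ *m _)]mulmxA [one^T *m (_ *m _)]mulmxA trmx_ones_ones V1 mul0mx scaler0 addr0.
by rewrite !mul_scalar_mx scalerA mulfVK.
Qed.

(** By symmetry [L] is annihilated by [ones] on both sides, so [P L = L P = L] and the multiple of
    [J] contributes nothing. *)
Lemma trace_projected (D L : 'M[R]_N) (t : R) :
  L^T = L -> L *m one = 0 ->
  \tr ((- (P *m D *m P) + t *: (one *m one^T)) *m L) = - \tr (D *m L).
Proof.
move=> Lsym L1.
have oneL : one^T *m L = 0 by rewrite -[L]Lsym -trmx_mul L1 trmx0.
have PL : P *m L = L.
  by rewrite mulmxBl mul1mx -scalemxAl -mulmxA oneL mulmx0 scaler0 subr0.
have LP : L *m P = L.
  by rewrite -[LHS]trmxK trmx_mul proj_ones_orth_sym Lsym PL.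
rewrite mulmxDl -scalemxAl -[one *m _ *m _]mulmxA oneL mulmx0 scaler0 addr0.
by rewrite mulNmx linearN /= -!mulmxA PL mxtrace_mulC -mulmxA LP.
Qed.

Lemma projected_shift_sym (D : 'M[R]_N) (t : R) : D^T = D ->
  let A := - (P *m D *m P) + t *: (one *m one^T) in A^T = A.
Proof.
move=> Dsym /=; rewrite linearD linearN linearZ /= !trmx_mul trmxK Dsym.
by rewrite proj_ones_orth_sym mulmxA.
Qed.
End Projection.

(** * The cosine gaps in increasing order *)

Lemma cosgap_sym (R : realType) N k : (k <= N)%N -> (0 < N)%N ->
  cosgap R N (N - k) = cosgap R N k.
Proof.
move=> kN N0; rewrite /cosgap; congr (1 - _).
have N0' : N%:R != 0 :> R by rewrite pnatr_eq0 -lt0n.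
have -> : 2 * pi * (N - k)%:R / N%:R = - (2 * pi * k%:R / N%:R) + pi *+ 2 :> R.
  by rewrite natrB// mulr2n; field.
by rewrite cosD2pi cosN.
Qed.

Lemma cosgap_incr (R : realType) N i j : (i <= j)%N -> (j.*2 <= N)%N ->
  cosgap R N i <= cosgap R N j.
Proof.
move=> ij jN; have [->|N0] := posnP N; first by rewrite /cosgap invr0 !mulr0.
rewrite lerD2l lerN2.
have P k : (k.*2 <= N)%N -> 2 * pi * k%:R / N%:R \in `[0, pi : R].
  move=> kN; rewrite in_itv /=; apply/andP; split.
    by rewrite divr_ge0// !mulr_ge0// pi_ge0.
  rewrite ler_pdivrMr ?ltr0n// [2 * pi]mulrC -mulrA -natrM mul2n.
  by rewrite ler_pM2l ?pi_gt0// ler_nat.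
rewrite leNgt ltr_cos ?P -?leNgt//.
  rewrite ler_pM2r ?invr_gt0 ?ltr0n// ler_pM2l ?mulr_gt0 ?pi_gt0//.
  by rewrite ler_nat.
by rewrite (leq_trans _ jN)// leq_double.
Qed.

(** The map [f] enumerates the indices as 1, N-1, 2, N-2, and so on. Since [N - k] and [k] have the
    same gap, the values come in increasing pairs. *)
Lemma sorted_cosgap (R : realType) N : (0 < N)%N ->
  sort <=%R [seq cosgap R N j | j <- iota 1 N.-1] =
  [seq cosgap R N (uphalf j) | j <- iota 1 N.-1].
Proof.
move=> N0; pose f j := if odd j then uphalf j else (N - j./2)%N.
have fiota : perm_eq (map f (iota 1 N.-1)) (iota 1 N.-1).
  have fu : uniq (map f (iota 1 N.-1)).
    rewrite map_inj_in_uniq ?iota_uniq// => i j; rewrite !mem_iota /f.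
    by case: (boolP (odd i)); case: (boolP (odd j)); lia.
  apply: uniq_perm; rewrite ?iota_uniq//.
  (* An injective image inside a list of the same size fills it. *)
  apply: (uniq_min_size fu _ _).2; last by rewrite size_map.
  move=> _ /mapP[i + ->]; rewrite !mem_iota /f.
  by case: (boolP (odd i)); lia.
have -> : [seq cosgap R N (uphalf j) | j <- iota 1 N.-1] =
          map (cosgap R N) (map f (iota 1 N.-1)).
  rewrite -map_comp; apply/eq_in_map => j; rewrite mem_iota /f /= => jN.
  by case: ifP => [//|jodd]; rewrite cosgap_sym ?uphalf_half ?jodd//; lia.
have psrt : sorted <=%R (map (cosgap R N) (map f (iota 1 N.-1))).
  rewrite -map_comp (@eq_in_map _ _ _ (cosgap R N \o uphalf) _).1.
    apply: (homo_sorted_in (P := fun j => (j < N)%N) (e := leq)).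
    - move=> i j iN jN ij; rewrite /= cosgap_incr// ?uphalf_half; lia.
    - by apply/allP => j; rewrite mem_iota; lia.
    - exact: iota_sorted.
  move=> j; rewrite mem_iota /f /= => jN.
  by case: ifP => [//|jodd]; rewrite cosgap_sym ?uphalf_half ?jodd//; lia.
rewrite -[RHS](sorted_sort le_trans psrt); apply/perm_sort_leP.
by rewrite perm_map// perm_sym.
Qed.

(** * The bound for a single tour *)

Lemma sorted_spectrum (R : realType) n (A : 'M[R]_n) :
  sorted (fun x y : R => y <= x) (spectrum A).
Proof. by apply: sort_sorted => x y; exact: le_total. Qed.

Lemma phi_le_tour_length (R : realType) (N : nat) (D : 'M[R]_N) (s : 'S_N) :
  (0 < N)%N -> D^T = D -> (forall i, D i i = 0) -> phi D <= tour_length D s.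
Proof.
move=> N0 Dsym D0; set M := projected_restriction D.
(* The eigenvalue of [ones] is moved from [0] to an upper bound [t] of the
   other ones, so that the sorted pairing matches it with [cosgap R N 0 = 0]. *)
pose t := \sum_(x <- spectrum M) `|x|.
pose A := - (proj_ones_orth R N *m D *m proj_ones_orth R N)
          + (t / N%:R) *: (ones R N *m (ones R N)^T).
have Asym : A^T = A by apply: projected_shift_sym.
have Ap : char_poly A = ('X - t%:P) * char_poly M by exact: char_poly_projected.
(* [M] is written in a basis not known to be orthonormal, so its characteristic polynomial is split
   through that of the symmetric [A], by removing the root [t]. *)
have [la lap] : exists la : seq R, char_poly A = \prod_(x <- la) ('X - x%:P).
  have [d [_ [_ _ ->]]] := symmetric_spectral Asym.
  by exists [seq d 0 i | i <- index_enum 'I_N]; rewrite big_map.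
have tla : t \in la.
  by rewrite -root_prod_XsubC -lap Ap rootM root_XsubC eqxx.
have Mp : char_poly M = \prod_(x <- spectrum M) ('X - x%:P).
  have Mla : char_poly M = \prod_(x <- rem t la) ('X - x%:P).
    apply: (mulfI (negbT (polyXsubC_eq0 t))).
    by rewrite -Ap lap (big_rem t).
  rewrite (spectrum_prod_XsubC Mla) Mla; apply/esym/perm_big.
  by rewrite perm_sort.
pose c := sort <=%R [seq cosgap R N j | j <- iota 1 N.-1].
pose L := half_laplacian R (s^-1 * cyclic_perm N * s)%g.
(* Index 0 gives the eigenvalue 0 of [L], placed in front of the sorted gaps. *)
have Lp : char_poly L = \prod_(x <- 0 :: c) ('X - x%:P).
  rewrite char_poly_tour_laplacian//.
  rewrite -(big_mkord xpredT (fun i => 'X - (cosgap R N i)%:P)).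
  rewrite big_ltn// big_cons.
  have -> : cosgap R N 0 = 0 by rewrite /cosgap mulr0 mul0r cos0 subrr.
  rewrite /c (perm_big _ (introT permPl (perm_sort _ _))) big_map.
  by rewrite /index_iota subn1.
have Asp : char_poly A = \prod_(x <- t :: spectrum M) ('X - x%:P).
  by rewrite big_cons -Mp.
have := trace_mul_ge Asym (half_laplacian_sym _ _) Asp Lp.
rewrite trace_projected ?half_laplacian_sym ?half_laplacian_ones//.
rewrite tour_length_trace// opprK.
(* The leading pair contributes [t * 0]; the shift by one then agrees with the [k.-1] in [mu] and
   [cseq]. *)
have -> : \sum_(i < N) (t :: spectrum M)`_i * (0 :: c)`_i = phi D.
  rewrite -(big_mkord xpredT (fun i => (t :: spectrum M)`_i * (0 :: c)`_i)).
  rewrite big_ltn//= mulr0 add0r /phi; apply: eq_big_nat => -[//|k] _ /=.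
  by rewrite mulrC.
apply.
  rewrite /= path_min_sorted ?sorted_spectrum//; apply/allP => x xM.
  rewrite /t (big_rem x)//= (le_trans (ler_norm x))// lerDl sumr_ge0//.
rewrite /= path_min_sorted; first exact: sort_le_sorted.
apply/allP => x; rewrite mem_sort => /mapP[k _ ->].
by rewrite subr_ge0 cos_le1.
Qed.

(** * Explicit formulas and conclusion *)

Lemma cseqE (R : realType) N k : (0 < k < N)%N ->
  cseq R N k = cosgap R N (uphalf k).
Proof.
case: k => // k /= kN.
rewrite /cseq sorted_cosgap ?(leq_trans _ kN)// (nth_map 0%N) ?size_iota ?nth_iota ?add1n//; lia.
Qed.

Lemma big_nat_pairs (V : nmodType) n (F : nat -> V) :
  \sum_(1 <= k < n.*2.+1) F k = \sum_(1 <= k < n.+1) (F (2 * k - 1)%N + F (2 * k)%N).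
Proof.
elim: n => [|n IH]; first by rewrite !big_geq.
rewrite doubleS !(@big_nat_recr _ _ _ _.+1) //= IH -addrA.
by congr (_ + (F _ + F _)); lia.
Qed.

(** Positions [2k - 1] and [2k] carry the same gap. The number [n] of pairs is left free so as to
    serve both parities of [N]. *)
Lemma phi_pairs (R : realType) N (D : 'M[R]_N) n : (n.*2 < N)%N ->
  \sum_(1 <= k < n.*2.+1) cseq R N k * mu D k =
  \sum_(1 <= k < n.+1) cosgap R N k * (mu D (2 * k - 1) + mu D (2 * k)).
Proof.
move=> nN; rewrite big_nat_pairs; apply: eq_big_nat => k kn.
rewrite !cseqE; try lia.
by rewrite mulrDr; congr (cosgap _ _ _ * _ + cosgap _ _ _ * _); lia.
Qed.

Theorem theorem1 (R : realType) (N : nat) (D : 'M[R]_N)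
    (hN : (2 <= N)%N)
    (Dsym : D^T = D)
    (Ddiag : forall i : 'I_N, D i i = 0) :
  [/\ phi D <= Lmin D,
      odd N ->
        phi D = \sum_(1 <= k < (N.-1)./2.+1)
                  (1 - cos (2 * pi * k%:R / N%:R))
                  * (mu D (2 * k - 1) + mu D (2 * k))
    & ~~ odd N ->
        phi D = \sum_(1 <= k < N./2)
                  (1 - cos (2 * pi * k%:R / N%:R))
                  * (mu D (2 * k - 1) + mu D (2 * k))
                + 2 * mu D N.-1].
Proof.
have N0 : (0 < N)%N by lia.
split.
(* Every competitor, including the default value of the minimum, is a tour length. *)
- apply: (big_ind (fun x => phi D <= x)) => [|x y px py|s _].
  + exact: phi_le_tour_length.
  + by rewrite le_min px py.
  + exact: phi_le_tour_length.
- move=> Nodd; rewrite -phi_pairs /phi; last lia.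
  by congr (\sum_(1 <= k < _) _); lia.
- move=> Neven; have [n NE] : exists n, N = n.+1.*2 by exists N./2.-1; lia.
  have -> : N./2 = n.+1 by lia.
  rewrite -phi_pairs /phi; last lia.
  have {1}-> : N = n.*2.+2 by lia.
  (* For even [N] the last index [N - 1] stays unpaired, with coefficient [1 - cos pi = 2]. *)
  rewrite big_nat_recr//=; congr (_ + _).
  rewrite cseqE; last lia.
  have -> : N.-1 = n.*2.+1 by lia.
  congr (_ * _).
  have -> : uphalf n.*2.+1 = n.+1 by lia.
  rewrite /cosgap NE.
  have -> : 2 * pi * n.+1%:R / n.+1.*2%:R = pi :> R.
    by rewrite -mul2n natrM [2 * pi * _]mulrAC [LHS]mulrC mulKf// mulf_neq0 ?pnatr_eq0.
  by rewrite cospi opprK.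
Qed.
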